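(* Let $G$ be an $r$-uniform hypergraph with no isolated vertices, let $H$ be an extension of $G$, and let $p>r$. Then \[ \Big(\Big(\frac{r+1}{r}\Big)^{p-r}\big(\lambda^{(p)}(G)\big)^p\Big)^{1/(p+1)} \leq\lambda^{(p+1)}(H)\leq\left(\frac{(r+1)^{p-r}}{r^{p+1-r}}\right)^{1/(p+1)}\lambda^{(p+1)}(G), \] where equality holds in the left inequality if and only if $H\cong G^{r+1}$, and equality holds in the right inequality if and only if $H\cong G*K_1$.
   Context: A $k$-uniform hypergraph $G$ consists of a finite vertex set $V(G)$ and a set $E(G)$ of $k$-element subsets of $V(G)$ (edges); a vertex is isolated if it lies in no edge. For $\bm{x}\in\mathbb{R}^{V(G)}$ let $P_G(\bm{x})=k\sum_{e\in E(G)}\prod_{v\in e}x_v$, and for real $p\ge1$ let $\|\bm{x}\|_p=(\sum_v|x_v|^p)^{1/p}$. The $p$-spectral radius is $\lambda^{(p)}(G)=\max_{\|\bm{x}\|_p=1}P_G(\bm{x})$. An extension of an $r$-uniform hypergraph $G$ is an $(r+1)$-uniform hypergraph obtained by adding to each edge $e\in E(G)$ a vertex $v_e\notin V(G)$ (so the edges are $e\cup\{v_e\}$, and the vertex set is $V(G)$ together with all the $v_e$), where the added vertices $v_e$ need not be distinct for different edges. $G^{r+1}$ is the extension in which all added vertices $v_e$ are pairwise distinct; $G*K_1$ is the extension in which all added vertices $v_e$ coincide with a single new vertex. *)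

(* Defs.v *)
From HB Require Import structures.
From mathcomp Require Import all_boot all_order all_algebra.
From mathcomp Require Import all_classical all_reals all_analysis.
Set Implicit Arguments.
Unset Strict Implicit.
Unset Printing Implicit Defensive.
Import Order.TTheory GRing.Theory Num.Theory.
Local Open Scope ring_scope.

Record uhypergraph (k : nat) := UHypergraph {
  vertex :> finType;
  edges : {set {set vertex}};
  edges_card : forall e, e \in edges -> #|e| = k }.

Definition no_isolated k (G : uhypergraph k) : Prop :=
  forall v : G, exists2 e, e \in edges G & v \in e.

Definition hiso k (G H : uhypergraph k) : Prop :=
  exists2 f : G -> H, bijective f &
    forall e : {set G}, (f @: e \in edges H) = (e \in edges G).

Definition hpoly (R : realType) k (G : uhypergraph k) (x : G -> R) : R :=
  k%:R * \sum_(e in edges G) \prod_(v in e) x v.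

Definition pnorm (R : realType) (V : finType) (p : R) (x : V -> R) : R :=
  (\sum_(v : V) `|x v| `^ p) `^ p^-1.

(* The maximum over the unit sphere of the p-norm, which is compact; when G has
   no vertex the sphere is empty and the value is sup set0 = 0. *)
Definition spectral_radius (R : realType) k (p : R) (G : uhypergraph k) : R :=
  sup [set hpoly x | x in [set x : G -> R | pnorm p x = 1]]%classic.

Section Extension.
Variables (r : nat) (G : uhypergraph r) (C : finType) (c : {set G} -> C).

(* An extension is given by labels: the vertex v_e added to the edge e is
   inr (c e), so v_e and v_e' coincide iff c e = c e'. Only the labels of edges
   of G yield vertices; the values of c on other sets are irrelevant. *)
Definition ext_vertex : finType := (G + {z : C | z \in c @: edges G})%type.

Definition ext_edge (e : {set G}) : {set ext_vertex} :=
  [set w : ext_vertex |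
    match w with inl v => v \in e | inr z => val z == c e end].

Lemma ext_edges_card E : E \in ext_edge @: edges G -> #|E| = r.+1.
Proof.
case/imsetP => e eG ->.
pose z0 : {z : C | z \in c @: edges G} := Sub (c e) (imset_f c eG).
have -> : ext_edge e = inr z0 |: inl @: e.
  apply/setP => -[v|z]; rewrite !inE.
    by rewrite /= mem_imset //; exact: inl_inj.
  have -> : (inr z \in [set inl x | x in e]) = false.
    by apply/imsetP => -[].
  rewrite orbF; apply/eqP/eqP => [zc|[->]//].
  by congr inr; exact: val_inj.
rewrite cardsU1 card_imset; last exact: inl_inj.
by rewrite (edges_card eG); case: imsetP => [[]|].
Qed.

Definition extension : uhypergraph r.+1 := UHypergraph ext_edges_card.

End Extension.

Definition is_extension r (G : uhypergraph r) (H : uhypergraph r.+1) : Prop :=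
  exists (C : finType) (c : {set G} -> C), hiso H (extension c).

(* G^{r+1}: the added vertices are pairwise distinct. *)
Definition ext_distinct r (G : uhypergraph r) : uhypergraph r.+1 :=
  extension (fun e : {set G} => e).

(* G * K_1: the added vertices all coincide. *)
Definition ext_join_K1 r (G : uhypergraph r) : uhypergraph r.+1 :=
  extension (fun _ : {set G} => tt).

(* Main.v *)
(** Write q = p + 1 and view a vector on an extension H as a pair (x, y), with x
    on V(G) and y on the labels.  Then P_H(x, y) = (r + 1) D(x, y), where
    D(x, y) = \sum_e y_(c e) \prod_(v in e) x_v, and rescaling x and y
    separately shows that lambda^(q)(H) is the maximum of D over pairs of q-unit
    vectors times a constant which comes from maximizing s t^r for s + t = 1.

    Upper bound: y <= 1, so D(x, y) <= \sum_e \prod_(v in e) x_v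
    <= lambda^(q)(G) / r.  Lower bound: take x_v = z_v^(p/q) for a maximizer z
    of P_G and optimize y by Hoelder; superadditivity of t^(q/p) over the edges
    sharing a label gives D >= (lambda^(p)(G) / r)^(p/q).

    Both equality cases rest on the positivity of maximizers, which holds
    because the exponent exceeds the uniformity: two labels force y < 1, and two
    edges sharing a label make superadditivity strict. *)

Require Import Defs.
From HB Require Import structures.
From mathcomp Require Import all_boot all_order all_algebra.
From mathcomp Require Import all_classical all_reals all_analysis.
From mathcomp Require Import ring.
Import Order.TTheory GRing.Theory Num.Theory.
Local Open Scope ring_scope.
Set Implicit Arguments.
Unset Strict Implicit.
Unset Printing Implicit Defensive.

(** * Existence of maximizers on the nonnegative unit sphere *)

Section Compactness.
Import numFieldNormedType.Exports ArrowAsProduct.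
Local Open Scope classical_set_scope.
Variable R : realType.

(** At 0 the radius e^(1/p) works directly; elsewhere the base is positive and the power is
    derivable there. *)
Lemma continuous_norm_powR (p : R) : 0 < p ->
  continuous (fun a : R => `|a| `^ p).
Proof.
move=> p0 a; have [->|a0] := eqVneq a 0.
  apply/cvgrPdist_lt => e e0; rewrite normr0 powR0 ?gt_eqF//.
  near=> t; rewrite sub0r normrN ger0_norm ?powR_ge0//.
  have -> : e = (e `^ p^-1) `^ p by rewrite -powRrM mulVf ?gt_eqF// powRr1 ?ltW.
  apply: gt0_ltr_powR => //; rewrite ?nnegrE ?powR_ge0//.
  by near: t; apply: (@nbhs0_lt R R); rewrite powR_gt0.
apply: (@continuous_comp _ _ _ (fun a : R => `|a|) (fun b => b `^ p)).
  exact: norm_continuous.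
apply: differentiable_continuous; apply/derivable1_diffP.
by apply: derivable_powR; rewrite in_itv/= andbT normr_gt0.
Unshelve. all: by end_near. Qed.

(** The nonnegative part of the sphere is a closed subset of the cube [0, 1]^V, compact by
    Tychonoff; the indicator of [v0] shows that it is nonempty. *)
Lemma sphere_max (V : finType) (p : R) (F : (V -> R) -> R) (v0 : V) :
  0 < p -> continuous F ->
  exists z : V -> R, [/\ forall v, 0 <= z v, \sum_v z v `^ p = 1 &
    forall x : V -> R, (forall v, 0 <= x v) -> \sum_v x v `^ p = 1 ->
      F x <= F z].
Proof.
move=> p0 Fc.
(* The absolute value makes [N] continuous on the whole space, not only on the cube. *)
pose N (x : V -> R) := \sum_v `|x v| `^ p.
pose B := [set x : V -> R | forall v, `[0, 1] (x v)].
have Nc : continuous (N : (V -> R) -> R).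
  apply: (@continuous_big R V +%R 0) => [x|v _ x].
    exact: add_continuous.
  apply: (@continuous_comp _ _ _ (fun x : V -> R => x v) (fun a => `|a| `^ p)).
    exact: (@proj_continuous V (fun=> R)).
  exact: continuous_norm_powR.
have Bc : compact (B `&` (N @^-1` [set 1])).
  apply: compact_closedI.
    apply: (@tychonoff V (fun=> R) (fun=> `[0, 1])) => _.
    exact: segment_compact.
  by apply: closed_comp => [x _|]; [exact: Nc|exact: closed_eq].
have NE x : (forall v, 0 <= x v) -> N x = \sum_v x v `^ p.
  by move=> x0; apply: eq_bigr => v _; rewrite ger0_norm.
have BP x : (forall v, 0 <= x v) -> \sum_v x v `^ p = 1 ->
    (B `&` (N @^-1` [set 1])) x.
  move=> x0 x1; split; last by rewrite /= NE.
  move=> v; rewrite /= in_itv/= x0/= leNgt; apply/negP => xv.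
  suff : 1 < \sum_v x v `^ p by rewrite x1 ltxx.
  rewrite (bigD1 v)//=; apply: ltr_wpDr.
    by apply: sumr_ge0 => *; exact: powR_ge0.
  by have := @gt0_ltr_powR _ p p0 1 (x v); rewrite powR1; apply; rewrite ?nnegrE.
have [||z zB zmax] := @compact_EVT_max (V -> R) R F _ _ Bc.
- exists (fun v => (v == v0)%:R); apply: BP => [v|]; first exact: ler0n.
  rewrite (bigD1 v0)//= eqxx powR1 big1 ?addr0// => v /negPf ->.
  by rewrite powR0 ?gt_eqF.
- exact: continuous_subspaceT.
move: zB; rewrite inE => -[zB z1].
have z0 v : 0 <= z v by move/(_ v): zB; rewrite /= in_itv => /andP[].
exists z; split => //; first by rewrite -NE.
by move=> x x0 x1; apply: zmax; rewrite inE; exact: BP.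
Qed.

Lemma continuous_hpoly k (G : uhypergraph k) :
  continuous (@hpoly R k G : (G -> R) -> R).
Proof.
move=> x; apply: (@continuous_comp (G -> R) _ _ _ (fun a : R => k%:R * a)).
  apply: (@continuous_big R {set G} +%R 0) => [y|e _ y].
    exact: add_continuous.
  apply: (@continuous_big R G *%R 1) => [a|v _ a]; first exact: mul_continuous.
  exact: (@proj_continuous G (fun=> R)).
exact: mulrl_continuous.
Qed.

End Compactness.

(** * The spectral radius: attainment, homogeneity, positivity of maximizers *)

Section SpectralRadius.
Variables (R : realType) (k : nat) (G : uhypergraph k) (p : R).
Hypothesis p_gt0 : 0 < p.

Lemma pnorm_eq1 (V : finType) (x : V -> R) :
  pnorm p x = 1 <-> \sum_v `|x v| `^ p = 1.
Proof.
rewrite /pnorm; split=> [/eqP|->]; last by rewrite powR1.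
have S0 : 0 <= \sum_v `|x v| `^ p by apply: sumr_ge0 => *; exact: powR_ge0.
by rewrite powR_eq1 ltNge S0 invr_eq0 (gt_eqF p_gt0) !orbF => /eqP.
Qed.

Lemma hpolyZ (a : R) (x : G -> R) :
  hpoly (fun v => a * x v) = a ^+ k * hpoly x.
Proof.
rewrite /hpoly mulrCA; congr (_ * _); rewrite big_distrr; apply: eq_bigr => e eG.
by rewrite big_split/= prodr_const (edges_card eG).
Qed.

Lemma sum_powRZ (V : finType) (A : {pred V}) (a : R) (x : V -> R) :
  0 <= a -> (forall v, 0 <= x v) ->
  \sum_(v in A) (a * x v) `^ p = a `^ p * \sum_(v in A) x v `^ p.
Proof.
by move=> a0 x0; rewrite big_distrr; apply: eq_bigr => v _; rewrite powRM.
Qed.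

Lemma sum_powR_normalized (V : finType) (A : {pred V}) (x : V -> R) (S : R) :
  (forall v, 0 <= x v) -> S = \sum_(v in A) x v `^ p -> 0 < S ->
  \sum_(v in A) ((S `^ p^-1)^-1 * x v) `^ p = 1.
Proof.
move=> x0 SE S0; rewrite sum_powRZ ?invr_ge0 ?powR_ge0// -SE.
rewrite -powRN -powRrM mulNr mulVf ?gt_eqF// powR_inv1 ?(ltW S0)//.
by rewrite mulVf ?gt_eqF.
Qed.

(** Passing from x to |x| keeps the norm and does not decrease the polynomial, so a maximizer among
    nonnegative vectors attains the supremum over the whole sphere. *)
Lemma spectral_radius_attained (v0 : G) :
  exists z : G -> R, [/\ forall v, 0 <= z v, \sum_v z v `^ p = 1,
    hpoly z = spectral_radius p G &
    forall x : G -> R, (forall v, 0 <= x v) -> \sum_v x v `^ p = 1 ->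
      hpoly x <= spectral_radius p G].
Proof.
have [z [z0 z1 zmax]] := sphere_max v0 p_gt0 (@continuous_hpoly R k G).
suff zE : hpoly z = spectral_radius p G.
  by exists z; split => // x x0 x1; rewrite -zE; exact: zmax.
apply/eqP; rewrite eq_le; apply/andP; split.
  apply: ub_le_sup.
    exists (hpoly z) => _ [x /pnorm_eq1 x1 <-].
    apply: (@le_trans _ _ (hpoly (fun v => `|x v|))).
      apply: ler_wpM2l => //; apply: ler_sum => e _.
      by rewrite (le_trans (ler_norm _))// normr_prod.
    exact: zmax.
  exists z => //; apply/pnorm_eq1; rewrite -[RHS]z1.
  by apply: eq_bigr => v _; rewrite ger0_norm.
apply: ge_sup.
  exists (hpoly z), z => //; apply/pnorm_eq1; rewrite -[RHS]z1.
  by apply: eq_bigr => v _; rewrite ger0_norm.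
move=> _ [x /pnorm_eq1 x1 <-].
apply: (@le_trans _ _ (hpoly (fun v => `|x v|))); last exact: zmax.
apply: ler_wpM2l => //; apply: ler_sum => e _.
by rewrite (le_trans (ler_norm _))// normr_prod.
Qed.

(** Homogeneity of degree k reduces to unit vectors. The zero vector cannot be normalized, but there
    both sides vanish because edges are nonempty. *)
Lemma hpoly_le_spectral_radius (x : G -> R) : (0 < k)%N ->
  (forall v, 0 <= x v) ->
  hpoly x <= spectral_radius p G * ((\sum_v x v `^ p) `^ p^-1) ^+ k.
Proof.
move=> k0 x0; set S := \sum_v _.
have S0 : 0 <= S by apply: sumr_ge0 => *; exact: powR_ge0.
have [Sz|Sn0] := eqVneq S 0.
  rewrite Sz powR0 ?invr_eq0 ?gt_eqF// expr0n gtn_eqF// mulr0.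
  rewrite /hpoly big1 ?mulr0// => e eG.
  have /card_gt0P[v ve] : (0 < #|e|)%N by rewrite (edges_card eG).
  rewrite (bigD1 v)//=; suff -> : x v = 0 by rewrite mul0r.
  have /(_ v isT) := psumr_eq0P (fun v _ => powR_ge0 (x v) p) Sz.
  exact: powR_eq0_eq0.
have Sp : 0 < S by rewrite lt0r Sn0.
have [v0 _|G0] := pickP (fun _ : G => true); last first.
  by move: Sn0; rewrite /S big1 ?eqxx// => v; have := G0 v.
have [z [_ _ _ zmax]] := spectral_radius_attained v0.
pose s := S `^ p^-1; have sp : 0 < s by exact: powR_gt0.
have : hpoly (fun v => s^-1 * x v) <= spectral_radius p G.
  apply: zmax => [v|]; first by rewrite mulr_ge0 ?invr_ge0 ?(ltW sp).
  exact: (@sum_powR_normalized G predT).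
by rewrite hpolyZ exprVn mulrC ler_pdivrMr// exprn_gt0.
Qed.

Lemma spectral_radius_gt0 (e : {set G}) : (0 < k)%N -> e \in edges G ->
  0 < spectral_radius p G.
Proof.
move=> k0 eG; have := @hpoly_le_spectral_radius (fun=> 1) k0 (fun=> ler01).
suff h : 0 < hpoly (fun _ : G => 1 : R).
  move=> /(lt_le_trans h); rewrite pmulr_lgt0// exprn_gt0// powR_gt0//.
  have /card_gt0P[v _] : (0 < #|e|)%N by rewrite (edges_card eG).
  rewrite (bigD1 v)//= powR1 ltr_pwDl//.
  exact: sumr_ge0.
rewrite /hpoly mulr_gt0 ?ltr0n// (bigD1 e)//= big1_eq ltr_pwDl//.
by apply: sumr_ge0 => ? _; exact: prodr_ge0.
Qed.

(* Raising the zero coordinates of [z] inside an edge to [d] gains at least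
   [c * d ^+ k] in the polynomial and costs [O(d `^ p)] in the norm, which is
   less for small [d] because [k < p]. *)
Lemma maximizer_gt0 (z : G -> R) (e : {set G}) (v : G) :
  (0 < k)%N -> k%:R < p ->
  (forall u, 0 <= z u) -> \sum_u z u `^ p = 1 ->
  hpoly z = spectral_radius p G ->
  e \in edges G -> v \in e -> 0 < z v.
Proof.
move=> k0 kp z0 z1 zmax eG ve; rewrite lt0r z0 andbT; apply/eqP => zv.
pose c := \prod_(u in e) (if z u == 0 then 1 else z u).
have c0 : 0 < c.
  by apply: prodr_gt0 => u _; case: ifPn => // zu; rewrite lt0r zu z0.
pose l := spectral_radius p G.
have l0 : 0 < l by exact: spectral_radius_gt0 eG.
have kR0 : 0 < k%:R :> R by rewrite ltr0n.
have pk0 : 0 < p - k%:R by rewrite subr_gt0.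
(* Chosen so that [eps < 1] and [l * eps < c]. With d^(p - k) = eps, the cost l k d^p = l k d^k eps
   then stays below the gain k d^k c. *)
pose eps := c / (l + c + 1).
have lc0 : 0 < l + c + 1 by rewrite !addr_gt0.
have eps0 : 0 < eps by rewrite divr_gt0.
have eps1 : eps < 1 by rewrite ltr_pdivrMr// mul1r -addrA ltr_wpDl ?ltW// ltrDl.
have leps : l * eps < c.
  rewrite /eps mulrCA gtr_pMr// ltr_pdivrMr// mul1r -addrA ltrDl.
  by rewrite addr_gt0.
pose d := eps `^ (p - k%:R)^-1.
have d0 : 0 < d by exact: powR_gt0.
have d1 : d <= 1.
  have := @ge0_ler_powR _ (p - k%:R)^-1 _ eps 1; rewrite powR1; apply.
  - by rewrite invr_ge0 ltW.
  - by rewrite nnegrE ltW.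
  - by rewrite nnegrE.
  - exact: ltW.
have dp : d `^ p = d ^+ k * eps.
  have kpE : k%:R + (p - k%:R) = p by rewrite addrC subrK.
  rewrite -{1}kpE powRD ?kpE ?(gt_eqF p_gt0)//.
  rewrite powR_mulrn ?ltW// /d -powRrM mulVf ?gt_eqF//.
  by rewrite powRr1// ltW.
pose z' u := if (u \in e) && (z u == 0) then d else z u.
have z'ge u : z u <= z' u.
  by rewrite /z'; case: ifP => // /andP[_ /eqP->]; exact: ltW.
have z'0 u : 0 <= z' u by exact: le_trans (z'ge u).
have N' : \sum_u z' u `^ p <= 1 + k%:R * d `^ p.
  have -> : k%:R * d `^ p = \sum_(u in e) d `^ p.
    by rewrite sumr_const (edges_card eG) mulr_natl.
  rewrite -z1.
  rewrite [X in _ <= _ + X]big_mkcond -big_split/=; apply: ler_sum => u _.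
  rewrite /z'; case: (u \in e) => /=; last by rewrite addr0.
  by case: eqP => _; rewrite ?lerDl ?lerDr powR_ge0.
have gain : l + k%:R * (d ^+ k * c) <= hpoly z'.
  rewrite /l -zmax /hpoly -mulrDr ler_wpM2l// (bigD1 e)//=.
  rewrite [X in _ <= X](bigD1 e)//= addrAC; apply: lerD; last first.
    by apply: ler_sum => f _; apply: ler_prod => u _; rewrite z0 z'ge.
  rewrite (bigD1 v)//= zv mul0r add0r.
  (* One factor d per vertex of [e]: a raised coordinate equals d, and any other satisfies z u >= d
     z u since d <= 1. *)
  have -> : d ^+ k = \prod_(u in e) d by rewrite prodr_const (edges_card eG).
  rewrite /c -big_split/=; apply: ler_prod => u ue.
  rewrite /z' ue/=; case: ifP => zu; first by rewrite mulr1 ltW/=.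
  by rewrite mulr_ge0 ?(ltW d0)//= ler_piMl.
have N1 : 1 <= \sum_u z' u `^ p.
  rewrite -z1; apply: ler_sum => u _.
  by apply: ge0_ler_powR; rewrite ?nnegrE// ltW.
have cost : hpoly z' <= l * (1 + k%:R * d `^ p).
  apply: (le_trans (hpoly_le_spectral_radius k0 z'0)).
  rewrite ler_wpM2l ?(ltW l0)//; apply: le_trans N'.
  (* The p-th power sum N is at least 1 and k / p <= 1, so N^(k/p) <= N: the bound becomes linear in
     N. *)
  rewrite -powR_mulrn ?powR_ge0// -powRrM; apply: ler1_powR => //.
  by rewrite mulrC ler_pdivrMr// mul1r ltW.
have := le_trans gain cost; rewrite mulrDr mulr1 lerD2l dp.
rewrite [leRHS]mulrCA ler_pM2l// [leRHS]mulrCA ler_pM2l ?exprn_gt0//.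
by rewrite leNgt leps.
Qed.

End SpectralRadius.

(** * Isomorphism invariance, and extensions determined by their partition of the edges *)

Section Isomorphism.

Lemma hiso_trans k (F G H : uhypergraph k) : hiso F G -> hiso G H -> hiso F H.
Proof.
move=> [f fbij fE] [g gbij gE]; exists (g \o f); first exact: bij_comp.
by move=> e; rewrite imset_comp gE fE.
Qed.

Lemma hiso_spectral_radius (R : realType) k (p : R) (G H : uhypergraph k) :
  hiso G H -> spectral_radius p G = spectral_radius p H.
Proof.
move=> [f fbij fE]; have [g fK gK] := fbij; have finj := can_inj fK.
have hpolyE (y : H -> R) : hpoly (y \o f) = hpoly y.
  rewrite /hpoly; congr (_ * _); symmetry.
  rewrite (reindex_onto (fun e : {set G} => f @: e) (fun e : {set H} => g @: e)).
    apply: eq_big => [e|e _].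
      rewrite fE -imset_comp (eq_imset _ fK) imset_id eqxx andbT//.
    by rewrite big_imset//= => u v _ _; exact: finj.
  by move=> e _; rewrite -imset_comp (eq_imset _ gK) imset_id.
have pnormE (y : H -> R) : pnorm p (y \o f) = pnorm p y.
  by rewrite /pnorm; congr (_ `^ _); rewrite [RHS](reindex f)//; exact: onW_bij.
rewrite /spectral_radius; congr sup; apply/seteqP; split=> _ [x /= x1 <-].
  have xE : x = (x \o g) \o f by apply/funext => v /=; rewrite fK.
  exists (x \o g); first by rewrite -pnormE -xE.
  by rewrite -hpolyE -xE.
by exists (x \o f); [rewrite /= pnormE|exact: hpolyE].
Qed.

Variables (r : nat) (G : uhypergraph r).

Definition label (C : finType) (c : {set G} -> C) : finType :=
  {z : C | z \in c @: edges G}%type.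

Lemma labelP (C : finType) (c : {set G} -> C) (z : label c) :
  exists2 e, e \in edges G & val z = c e.
Proof. exact/imsetP/(valP z). Qed.

Definition label_edge (C : finType) (c : {set G} -> C) (z : label c) : {set G} :=
  s2val (cid2 (labelP z)).

Lemma label_edgeP (C : finType) (c : {set G} -> C) (z : label c) :
  label_edge z \in edges G /\ c (label_edge z) = val z.
Proof. by rewrite /label_edge; case: cid2. Qed.

Definition edge_label (C : finType) (c : {set G} -> C) (e : {set G})
    (eG : e \in edges G) : label c :=
  exist (fun z => z \in c @: edges G) (c e) (imset_f c eG).

(** A label vertex goes to the [d]-label of a chosen edge carrying it; the choice is immaterial once
    [c] and [d] identify the same edges. *)
Definition relabel (C D : finType) (c : {set G} -> C) (d : {set G} -> D)
    (w : extension c) : extension d :=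
  match w with
  | inl v => inl v
  | inr z => inr (edge_label d (proj1 (label_edgeP z)))
  end.

Definition same_labels (C D : finType) (c : {set G} -> C) (d : {set G} -> D) :=
  {in edges G &, forall e e', (c e == c e') = (d e == d e')}.

Lemma relabelK (C D : finType) (c : {set G} -> C) (d : {set G} -> D) :
  same_labels c d -> cancel (relabel d) (@relabel D C d c).
Proof.
move=> cd [//|z] /=; congr inr; apply: val_inj => /=.
set z' := edge_label d _; have [zE <-] := label_edgeP z.
(* The edge chosen on the way back may be another one, but it shares its [d]-label, hence its
   [c]-label, with the first. *)
have [z'E z'd] := label_edgeP z'.
by apply/eqP; rewrite cd// z'd.
Qed.

Lemma relabel_ext_edge (C D : finType) (c : {set G} -> C) (d : {set G} -> D)
    (e : {set G}) : same_labels c d -> e \in edges G ->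
  relabel d @: (ext_edge c e : {set extension c}) = ext_edge d e.
Proof.
move=> cd eG.
have dc : same_labels d c by move=> e1 e2 *; rewrite cd.
apply/setP => w; rewrite -[w in LHS](relabelK dc).
rewrite mem_imset; last exact: can_inj (relabelK cd).
rewrite !inE; case: w => //= z.
have [zE zc] := label_edgeP z.
by rewrite cd// zc.
Qed.

Lemma hiso_extension (C D : finType) (c : {set G} -> C) (d : {set G} -> D) :
  same_labels c d -> hiso (extension c) (extension d).
Proof.
move=> cd; have dc : same_labels d c by move=> e1 e2 *; rewrite cd.
have inj := can_inj (relabelK cd).
exists (relabel d); first exact: Bijective (relabelK cd) (relabelK dc).
move=> A; apply/imsetP/imsetP => -[e eG AE]; exists e => //; last first.
  by rewrite AE relabel_ext_edge.
by apply: (imset_inj inj); rewrite AE relabel_ext_edge.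
Qed.

End Isomorphism.

(** * Reduction of the radius of an extension to a form in two unit vectors *)

Section ExtensionRadius.
Variables (R : realType) (r : nat) (G : uhypergraph r).
Variables (C : finType) (c : {set G} -> C).
Hypothesis r_gt0 : (0 < r)%N.

Definition ext_fun (x : G -> R) (y : C -> R) (w : extension c) : R :=
  match w with inl v => x v | inr z => y (val z) end.

Lemma ext_funE (X : extension c -> R) :
  exists y : C -> R, [/\ X = ext_fun (fun v => X (inl v)) y,
    (forall w, 0 <= X w) -> forall l, 0 <= y l &
    (forall w, 0 < X w) -> forall l, l \in c @: edges G -> 0 < y l].
Proof.
(* The default 0 off the labels of edges keeps [y] nonnegative on all of [C]; positivity is claimed
   only on those labels. *)
exists (fun l => if insub l is Some z then X (inr z) else 0); split.
- by apply/funext => -[//|z] /=; rewrite valK.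
- by move=> X0 l; case: insubP.
- by move=> X0 l lE; rewrite insubT.
Qed.

(** This is the form D(x, y) of the overview. *)
Definition ext_form (x : G -> R) (y : C -> R) : R :=
  \sum_(e in edges G) y (c e) * \prod_(v in e) x v.

Lemma hpoly_ext_fun x y :
  hpoly (ext_fun x y) = r.+1%:R * ext_form x y.
Proof.
have ext_edge_inj : injective (ext_edge c).
  move=> e e' /setP ee'; apply/setP => v.
  by have := ee' (inl v); rewrite !inE.
rewrite /hpoly big_imset/=; last by move=> *; exact: ext_edge_inj.
congr (_ * _); apply: eq_bigr => e eG.
rewrite (bigD1 (inr (edge_label c eG)))/=; last by rewrite inE/=.
congr (_ * _); rewrite big_sumType/= [X in _ * X]big1 ?mulr1.
  by apply: eq_bigl => v; rewrite inE/= andbT.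
move=> z /andP[]; rewrite inE/= => /eqP zc /eqP[]; congr inr.
exact: val_inj.
Qed.

Lemma sum_ext_fun (q : R) x y :
  \sum_w ext_fun x y w `^ q =
  \sum_v x v `^ q + \sum_(l in c @: edges G) y l `^ q.
Proof.
rewrite big_sumType/=; congr (_ + _).
by rewrite (big_sub _ (fun l => y l `^ q)).
Qed.

(* The maximum of [s * t ^+ r] over [s, t >= 0] with [s + t = 1], reached at
   [s = 1 / (r + 1)]. *)
Definition split_max : R := r.+1%:R^-1 * (r%:R / r.+1%:R) ^+ r.

(** AM-GM for the r + 1 numbers s, t/r, ..., t/r, whose mean is 1/(r + 1). *)
Lemma split_le (s t : R) : 0 <= s -> 0 <= t -> s + t = 1 ->
  s * t ^+ r <= split_max.
Proof.
move=> s0 t0 st1; have rR0 : 0 < r%:R :> R by rewrite ltr0n.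
pose f (i : 'I_r.+1) := if i == ord0 then s else t / r%:R.
have [|le _] := @leif_AGM R _ xpredT f.
  by move=> i _; rewrite /f; case: ifP => // _; rewrite divr_ge0 ?(ltW rR0).
move: le; rewrite big_ord_recl/= [X in X / _]big_ord_recl/=.
rewrite /f eqxx prodr_const sumr_const card_ord.
have -> : (t / r%:R) *+ r = t by rewrite -mulr_natr divfK ?gt_eqF.
rewrite st1 div1r cardE/= size_enum_ord exprS => le.
rewrite /split_max -(ler_pM2r (_ : 0 < r%:R^-1 ^+ r)) ?exprn_gt0 ?invr_gt0//.
rewrite -!mulrA -!exprMn; apply: (le_trans le).
by rewrite mulrAC divff ?gt_eqF// mul1r.
Qed.


Lemma split_max_gt0 : 0 < split_max.
Proof. by rewrite mulr_gt0 ?exprn_gt0 ?divr_gt0 ?invr_gt0 ?ltr0n. Qed.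

(** The first factor is the one in [hpoly]; the second comes from the best distribution of the q-th
    power sum between V(G) and the labels. *)
Definition split_const (q : R) : R := r.+1%:R * split_max `^ q^-1.

Lemma split_const_gt0 q : 0 < split_const q.
Proof. by rewrite mulr_gt0 ?ltr0n// powR_gt0// split_max_gt0. Qed.

Lemma ext_formZ (a b : R) x y :
  ext_form (fun v => a * x v) (fun l => b * y l) = b * a ^+ r * ext_form x y.
Proof.
rewrite /ext_form big_distrr; apply: eq_bigr => e eG.
by rewrite big_split/= prodr_const (edges_card eG) mulrACA.
Qed.

Lemma split_const_le (q : R) x y : 0 < q ->
  (forall v, 0 <= x v) -> (forall l, 0 <= y l) ->
  \sum_v x v `^ q = 1 -> \sum_(l in c @: edges G) y l `^ q = 1 ->
  split_const q * ext_form x y <= spectral_radius q (extension c).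
Proof.
move=> q0 x0 y0 x1 y1.
(* The optimal split: scaling by s^(1/q) and t^(1/q) gives the labels mass s and V(G) mass t. *)
pose s : R := r.+1%:R^-1; pose t : R := r%:R / r.+1%:R.
have s0 : 0 <= s by rewrite invr_ge0.
have t0 : 0 <= t by rewrite divr_ge0.
pose X := ext_fun (fun v => t `^ q^-1 * x v) (fun l => s `^ q^-1 * y l).
have X0 w : 0 <= X w by case: w => [v|z]; rewrite /= mulr_ge0 ?powR_ge0.
have rootK a : 0 <= a -> (a `^ q^-1) `^ q = a.
  by move=> a0; rewrite -powRrM mulVf ?gt_eqF// powRr1.
have X1 : \sum_w X w `^ q = 1.
  rewrite sum_ext_fun sum_powRZ ?powR_ge0// (@sum_powRZ _ _ _ predT) ?powR_ge0//.
  rewrite x1 y1 !mulr1 !rootK// /s /t -[X in _ + X]mul1r -mulrDl natr1 divff//.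
have := hpoly_le_spectral_radius q0 (ltn0Sn r) X0.
rewrite X1 powR1 expr1n mulr1 hpoly_ext_fun ext_formZ mulrA.
suff -> : s `^ q^-1 * (t `^ q^-1) ^+ r = split_max `^ q^-1 by [].
rewrite [RHS]powRM ?exprn_ge0// -powR_mulrn ?powR_ge0// powRAC powR_mulrn//.
Qed.

(** Converse of [split_const_le]: both halves of a maximizer are normalized separately. Every vertex
    of the extension lies in an edge, so the maximizer is positive, both masses are nonzero and
    strict inequalities become available later. *)
Lemma extension_attained (q : R) (e : {set G}) : no_isolated G ->
  r.+1%:R < q -> e \in edges G ->
  exists x : G -> R, exists y : C -> R,
    [/\ forall v, 0 < x v, forall l, 0 <= y l,
        forall l, l \in c @: edges G -> 0 < y l &
    [/\ \sum_v x v `^ q = 1, \sum_(l in c @: edges G) y l `^ q = 1 &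
        spectral_radius q (extension c) <= split_const q * ext_form x y]].
Proof.
move=> Gni rq eG.
have q0 : 0 < q by apply: le_lt_trans rq.
have [z [z0 z1 zE _]] :=
  @spectral_radius_attained R _ (extension c) q q0 (inr (edge_label c eG)).
have zpos w : 0 < z w.
  have [f fG wf] : exists2 f, f \in edges G & w \in (ext_edge c f : {set extension c}).
    case: w => [v|l]; first by have [f fG vf] := Gni v; exists f; rewrite ?inE.
    by have [f fG lf] := labelP l; exists f; rewrite ?inE//=; apply/eqP.
  exact: (@maximizer_gt0 _ _ _ _ q0 z (ext_edge c f) w _ _ z0 z1 zE (imset_f _ fG)).
have [y [zy y0 ypos]] := ext_funE z; set x := (fun v => z (inl v)) in zy.
have {}y0 := y0 z0; have {}ypos := ypos zpos.
have xpos v : 0 < x v by exact: zpos.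
have x0 v : 0 <= x v by exact: ltW.
pose S := \sum_(v in G) x v `^ q; pose T := \sum_(l in c @: edges G) y l `^ q.
have S0 : 0 < S.
  have /card_gt0P[v _] : (0 < #|e|)%N by rewrite (edges_card eG).
  rewrite /S (bigD1 v)//= ltr_pwDl ?powR_gt0//.
  by apply: sumr_ge0 => *; exact: powR_ge0.
have T0 : 0 < T.
  rewrite /T (bigD1 (c e))/=; last exact: imset_f.
  rewrite ltr_pwDl ?powR_gt0 ?ypos ?imset_f//.
  by apply: sumr_ge0 => *; exact: powR_ge0.
have ST : T + S = 1 by rewrite addrC -z1 zy sum_ext_fun.
pose a := S `^ q^-1; pose b := T `^ q^-1.
have a0 : 0 < a by exact: powR_gt0.
have b0 : 0 < b by exact: powR_gt0.
exists (fun v => a^-1 * x v), (fun l => b^-1 * y l); split.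
- by move=> v; rewrite mulr_gt0 ?invr_gt0.
- by move=> l; rewrite mulr_ge0 ?invr_ge0 ?(ltW b0).
- by move=> l lE; rewrite mulr_gt0 ?invr_gt0 ?ypos.
split.
- exact: (@sum_powR_normalized _ _ q0 G predT).
- exact: sum_powR_normalized.
rewrite -zE zy hpoly_ext_fun /split_const -mulrA ler_pM2l ?ltr0n// ext_formZ.
rewrite mulrA ler_peMl//.
  apply: sumr_ge0 => f fG; rewrite mulr_ge0 ?y0//; exact: prodr_ge0.
rewrite exprVn -invfM -[_ * _^-1]/(_ / _) ler_pdivlMr ?mulr_gt0 ?exprn_gt0// mul1r.
(* The factor lost by normalizing is thus at most [split_max] to the power 1/q, by [split_le] with T
   + S = 1. *)
have -> : b * a ^+ r = (T * S ^+ r) `^ q^-1.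
  rewrite powRM ?exprn_ge0 ?(ltW S0) ?(ltW T0)// -[in RHS]powR_mulrn ?(ltW S0)//.
  by rewrite powRAC powR_mulrn// ltW.
apply: ge0_ler_powR; rewrite ?nnegrE ?invr_ge0 ?(ltW q0) ?(ltW split_max_gt0)//.
  by rewrite mulr_ge0 ?exprn_ge0 ?(ltW S0) ?(ltW T0).
by apply: split_le; rewrite ?(ltW S0) ?(ltW T0).
Qed.

End ExtensionRadius.

(** * Hoelder's inequality and rules for real powers *)

Lemma holder_unit_sum (R : realType) (I : finType) (A : {pred I}) (f g : I -> R)
    (a b : R) :
  0 < a -> 0 < b -> a^-1 + b^-1 = 1 ->
  (forall i, 0 <= f i) -> (forall i, 0 <= g i) ->
  \sum_(i in A) f i `^ a = 1 ->
  \sum_(i in A) f i * g i <= (\sum_(i in A) g i `^ b) `^ b^-1.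
Proof.
move=> a0 b0 ab f0 g0 f1; set N := \sum_(i in A) g i `^ b.
have N0 : 0 <= N by apply: sumr_ge0 => *; exact: powR_ge0.
have [Nz|Nn0] := eqVneq N 0.
  rewrite Nz powR0 ?invr_eq0 ?gt_eqF// big1// => i iA.
  have /(_ i iA)/powR_eq0_eq0 -> := psumr_eq0P (fun i _ => powR_ge0 (g i) b) Nz.
  by rewrite mulr0.
have Np : 0 < N by rewrite lt0r Nn0.
pose n := N `^ b^-1; have n0 : 0 < n by exact: powR_gt0.
rewrite -[leRHS]mul1r -/n -ler_pdivrMr// mulr_suml -ab.
have gn1 : \sum_(i in A) (n^-1 * g i) `^ b = 1 by exact: sum_powR_normalized.
(* Spreading 1/a + 1/b over the indices reduces the claim to Young's inequality in each term. *)
have -> : a^-1 + b^-1 = \sum_(i in A) (f i `^ a / a + (n^-1 * g i) `^ b / b).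
  by rewrite big_split/= -!mulr_suml f1 gn1 !mul1r.
apply: ler_sum => i iA; rewrite -mulrA [g i / n]mulrC.
by apply: conjugate_powR; rewrite ?mulr_ge0 ?invr_ge0 ?(ltW n0).
Qed.

Lemma powRV (R : realType) (x y : R) : 0 <= x -> x^-1 `^ y = (x `^ y)^-1.
Proof. by move=> x0; rewrite -powR_inv1// powRAC powR_inv1// powR_ge0. Qed.

Lemma powR_prod (R : realType) (I : finType) (A : {pred I}) (f : I -> R) (a : R) :
  (forall i, 0 <= f i) ->
  (\prod_(i in A) f i) `^ a = \prod_(i in A) f i `^ a.
Proof.
move=> f0; suff [] : 0 <= \prod_(i in A) f i /\
  (\prod_(i in A) f i) `^ a = \prod_(i in A) f i `^ a by [].
apply: (big_rec2 (fun u v => 0 <= u /\ u `^ a = v)).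
  by rewrite powR1.
by move=> i u v _ [v0 <-]; rewrite powRM// mulr_ge0.
Qed.

(** * The two bounds and their equality cases, with q = p + 1 *)

Section Bounds.
Variables (R : realType) (r : nat) (G : uhypergraph r).
Variables (C : finType) (c : {set G} -> C) (p : R).
Hypotheses (r_gt0 : (0 < r)%N) (Gni : no_isolated G) (rp : r%:R < p).

Let r0 : 0 < r%:R :> R. Proof. by rewrite ltr0n. Qed.
Let p0 : 0 < p. Proof. exact: lt_trans rp. Qed.
Let q := p + 1.
Let q0 : 0 < q. Proof. by rewrite addr_gt0. Qed.
Let rq : r.+1%:R < q. Proof. by rewrite -natr1 ltrD2r. Qed.

Lemma split_const_upper :
  ((r%:R + 1) `^ (p - r%:R) / r%:R `^ (p + 1 - r%:R)) `^ (1 / (p + 1)) =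
  split_const r q / r%:R.
Proof.
have a0 : 0 < r.+1%:R :> R by rewrite ltr0n.
have -> : split_const r q / r%:R =
    ((r.+1%:R / r%:R) `^ q * split_max R r) `^ q^-1.
  rewrite powRM ?powR_ge0 ?(ltW (split_max_gt0 _ _))// -powRrM divff ?gt_eqF//.
  by rewrite powRr1 ?divr_ge0// /split_const mulrAC.
rewrite natr1 div1r; congr (_ `^ _).
(* In this form the power of r + 1 splits into (r + 1)^q over (r + 1)^(r+1), matching [split_max];
   the remaining powers are then generalized to independent variables for [field]. *)
have -> : p - r%:R = q - r.+1%:R by rewrite -natr1 /q; ring.
rewrite -/q powRM ?invr_ge0// powRV// !powRB ?(gt_eqF a0) ?(gt_eqF r0) ?implybT//.
rewrite !powR_mulrn// /split_max expr_div_n exprS.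
have := powR_gt0 q r0; have := exprn_gt0 r r0; have := exprn_gt0 r a0.
move: (r%:R `^ q) (r.+1%:R `^ q) (r%:R ^+ r) (r.+1%:R ^+ r) => B A b a.
move: a0; move: (r.+1%:R) => a1 /gt_eqF a10 /gt_eqF a_0 /gt_eqF b_0 /gt_eqF B0.
by field; rewrite a10 a_0 b_0 B0.
Qed.

Lemma split_const_lower (l : R) : 0 <= l ->
  (((r%:R + 1) / r%:R) `^ (p - r%:R) * l `^ p) `^ (1 / (p + 1)) =
  split_const r q * (l / r%:R) `^ (p / q).
Proof.
move=> l0; have a0 : 0 < r.+1%:R :> R by rewrite ltr0n.
have -> : split_const r q * (l / r%:R) `^ (p / q) =
    (r.+1%:R `^ q * split_max R r * (l / r%:R) `^ p) `^ q^-1.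
  have := ltW (split_max_gt0 R r_gt0); rewrite /split_const.
  move: (split_max R r) (l / r%:R) => m x m0.
  rewrite powRM ?mulr_ge0 ?powR_ge0// powRM ?powR_ge0//.
  by rewrite -!powRrM divff ?gt_eqF// powRr1.
rewrite natr1 div1r; congr (_ `^ _).
rewrite powRM ?invr_ge0// powRM ?invr_ge0// !powRV//.
have -> : r.+1%:R `^ (p - r%:R) = r.+1%:R `^ (q - r.+1%:R).
  by congr (_ `^ _); rewrite -natr1 /q; ring.
rewrite !powRB ?(gt_eqF a0) ?(gt_eqF r0) ?implybT//.
rewrite !powR_mulrn// /split_max expr_div_n exprS.
have := powR_gt0 p r0; have := exprn_gt0 r r0; have := exprn_gt0 r a0.
move: (r%:R `^ p) (r.+1%:R `^ q) (r%:R ^+ r) (r.+1%:R ^+ r) => B A b a.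
move: a0; move: (r.+1%:R) => a1 /gt_eqF a10 /gt_eqF a_0 /gt_eqF b_0 /gt_eqF B0.
by field; rewrite a10 a_0 b_0 B0.
Qed.

Let sum_edges (x : G -> R) :
  \sum_(e in edges G) \prod_(v in e) x v = hpoly x / r%:R.
Proof. by rewrite /hpoly mulrAC divff ?gt_eqF// mul1r. Qed.

Lemma unit_coord_le1 (V : finType) (A : {pred V}) (y : V -> R) (l : V) :
  l \in A -> 0 <= y l -> \sum_(i in A) y i `^ q = 1 -> y l <= 1.
Proof.
move=> lA yl0 y1; rewrite leNgt; apply/negP => yl1.
suff : 1 < \sum_(i in A) y i `^ q by rewrite y1 ltxx.
rewrite (bigD1 l)//= ltr_wpDr ?sumr_ge0// => [i _|]; first exact: powR_ge0.
by have := @gt0_ltr_powR _ q q0 1 (y l); rewrite powR1; apply; rewrite ?nnegrE.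
Qed.

Lemma unit_coord_lt1 (V : finType) (A : {pred V}) (y : V -> R) (l m : V) :
  l \in A -> m \in A -> l != m -> 0 < y m ->
  \sum_(i in A) y i `^ q = 1 -> y l < 1.
Proof.
move=> lA mA lm ym y1; rewrite ltNge; apply/negP => yl1.
suff : 1 < \sum_(i in A) y i `^ q by rewrite y1 ltxx.
rewrite (bigD1 l)//= (bigD1 m)/=; last by rewrite mA eq_sym.
apply: ltr_pwDr.
- by rewrite ltr_pwDl ?powR_gt0// sumr_ge0// => *; exact: powR_ge0.
- have := @ge0_ler_powR _ q (ltW q0) 1 (y l); rewrite powR1; apply=> //.
    by rewrite nnegrE.
  by rewrite nnegrE (le_trans ler01).
Qed.

Lemma sum_edges_le (x : G -> R) : (forall v, 0 <= x v) ->
  \sum_v x v `^ q = 1 ->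
  \sum_(e in edges G) \prod_(v in e) x v <= spectral_radius q G / r%:R.
Proof.
move=> x0 x1; rewrite sum_edges ler_pM2r ?invr_gt0//.
have := hpoly_le_spectral_radius q0 r_gt0 x0.
by rewrite x1 powR1 expr1n mulr1.
Qed.

Lemma extension_le_upper (e : {set G}) : e \in edges G ->
  spectral_radius q (extension c) <=
    split_const r q * (spectral_radius q G / r%:R).
Proof.
move=> eG.
have [x [y [xpos y0 _ [x1 y1 le]]]] := extension_attained c r_gt0 Gni rq eG.
apply: (le_trans le); rewrite ler_pM2l ?split_const_gt0//.
apply: le_trans (sum_edges_le (fun v => ltW (xpos v)) x1).
apply: ler_sum => f fG; rewrite ler_piMl//.
  by apply: prodr_ge0 => v _; exact: ltW.
exact: unit_coord_le1 (imset_f c fG) (y0 _) y1.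
Qed.

Lemma extension_lt_upper (f g : {set G}) :
  f \in edges G -> g \in edges G -> c f != c g ->
  spectral_radius q (extension c) <
    split_const r q * (spectral_radius q G / r%:R).
Proof.
move=> fG gG fg.
have [x [y [xpos y0 ypos [x1 y1 le]]]] := extension_attained c r_gt0 Gni rq fG.
apply: (le_lt_trans le); rewrite ltr_pM2l ?split_const_gt0//.
apply: lt_le_trans (sum_edges_le (fun v => ltW (xpos v)) x1).
apply: ltr_sum => [|e eG]; first by apply/hasP; exists f; rewrite ?mem_index_enum.
rewrite gtr_pMl; last by apply: prodr_gt0.
(* As two labels occur, each label misses some other one; its positive coordinate forces
   [y (c e) < 1]. *)
have [m mE em] : exists2 m, m \in c @: edges G & c e != m.
  have [->|] := eqVneq (c e) (c f); first by exists (c g); rewrite ?imset_f.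
  by exists (c f); rewrite ?imset_f.
exact: unit_coord_lt1 (imset_f c eG) mE em (ypos _ mE) y1.
Qed.

Lemma upper_le_extension (e : {set G}) : e \in edges G ->
  {in edges G &, forall f g, c f = c g} ->
  split_const r q * (spectral_radius q G / r%:R) <=
    spectral_radius q (extension c).
Proof.
move=> eG cE.
have /card_gt0P[v0 _] : (0 < #|e|)%N by rewrite (edges_card eG).
have [x [x0 x1 xmax _]] := spectral_radius_attained q0 v0.
(* With a single label the constant 1 is a q-unit vector on the labels. *)
have -> : spectral_radius q G / r%:R = ext_form c x (fun=> 1).
  by rewrite -xmax -sum_edges; apply: eq_bigr => f _; rewrite mul1r.
apply: split_const_le => //.
have -> : c @: edges G = [set c e].
  apply/setP => l; rewrite inE; apply/imsetP/eqP => [[f fG ->]|->].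
    exact: cE.
  by exists e.
by rewrite big_set1 powR1.
Qed.

(* The witness is [x = z `^ (p / q)] with [z] a maximizer for [G], and, for
   this [x], the equality case of Hoelder's inequality for [y]. *)
Lemma lower_le_extension (e : {set G}) : e \in edges G ->
  exists B : R,
    [/\ spectral_radius p G / r%:R <= B,
        split_const r q * B `^ (p / q) <= spectral_radius q (extension c) &
        forall f g, f \in edges G -> g \in edges G -> f != g -> c f = c g ->
          spectral_radius p G / r%:R < B].
Proof.
move=> eG.
have /card_gt0P[v0 _] : (0 < #|e|)%N by rewrite (edges_card eG).
have [z [z0 z1 zmax _]] := spectral_radius_attained p0 v0.
have zpos v : 0 < z v.
  have [f fG vf] := Gni v.
  exact: (@maximizer_gt0 _ _ _ _ p0 z f v r_gt0 rp z0 z1 zmax fG vf).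
pose x v := z v `^ (p / q).
have x0 v : 0 <= x v by exact: powR_ge0.
have x1 : \sum_v x v `^ q = 1.
  by rewrite -z1; apply: eq_bigr => v _; rewrite -powRrM divfK ?gt_eqF.
pose w (f : {set G}) := \prod_(v in f) x v.
have wpos f : 0 < w f by apply: prodr_gt0 => v _; exact: powR_gt0.
pose W l := \sum_(f in edges G | c f == l) w f.
have W0 l : 0 <= W l by apply: sumr_ge0 => f _; exact: ltW.
(* The exponent conjugate to q is q/p, and equality in Hoelder requires y^q proportional to
   W^(q/p). *)
pose y l := W l `^ p^-1.
have y0 l : 0 <= y l by exact: powR_ge0.
have wW f : f \in edges G -> w f <= W (c f).
  move=> fG; rewrite /W (bigD1 f) ?fG ?eqxx//= lerDl.
  by apply: sumr_ge0 => h _; exact: ltW.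
(* An edge alone on its label contributes exactly its term for [z]; by [wW], sharing a label can
   only increase the contribution. *)
have wp f : w f `^ p^-1 * w f = \prod_(v in f) z v.
  rewrite -[X in _ * X]powRr1 ?(ltW (wpos f))// -powRD ?gt_eqF ?addr_gt0 ?invr_gt0//.
  have -> : w f = (\prod_(v in f) z v) `^ (p / q).
    by rewrite powR_prod.
  rewrite -powRrM (_ : p / q * _ = 1) ?powRr1 ?prodr_ge0//.
  by rewrite /q; field; rewrite ?(gt_eqF p0) ?(gt_eqF q0).
pose B := ext_form c x y.
have lB f : f \in edges G -> \prod_(v in f) z v <= y (c f) * w f.
  move=> fG; rewrite -wp ler_pM2r//.
  by apply: ge0_ler_powR; rewrite ?nnegrE ?invr_ge0 ?(ltW p0) ?W0 ?wW// ltW.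
have lE : spectral_radius p G / r%:R = \sum_(f in edges G) \prod_(v in f) z v.
  by rewrite -zmax sum_edges.
have B0 : 0 < B.
  apply: lt_le_trans (_ : spectral_radius p G / r%:R <= B).
    by rewrite divr_gt0// (spectral_radius_gt0 p0 r_gt0 eG).
  by rewrite lE; exact: ler_sum.
(* The vector [y] is not normalized: its form and its q-th power sum are both B, so dividing by
   B^(1/q) leaves B^(1 - 1/q) = B^(p/q). *)
have BE : B = \sum_(l in c @: edges G) y l `^ q.
  rewrite /B /ext_form (partition_big_imset c)/=; apply: eq_bigr => l _.
  rewrite (eq_bigr (fun f => y l * w f)); last by move=> f /andP[_ /eqP->].
  rewrite -big_distrr/= -/(W l) -powRrM mulrDr mulr1 mulVf ?gt_eqF//.
  rewrite powRD ?powRr1 1?mulrC//.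
  by rewrite gt_eqF// addr_gt0 ?invr_gt0.
exists B; split.
- by rewrite lE; exact: ler_sum.
- pose b := (B `^ q^-1)^-1.
  have b0 : 0 <= b by rewrite invr_ge0 powR_ge0.
  have := split_const_le q0 x0 (fun l => mulr_ge0 b0 (y0 l)) x1
    (sum_powR_normalized q0 y0 BE B0).
  suff -> : ext_form c x (fun l => b * y l) = B `^ (p / q) by [].
  have -> : p / q = 1 - q^-1 by rewrite /q; field; rewrite (gt_eqF q0).
  rewrite powRB ?powRr1 ?(ltW B0) ?(gt_eqF B0) ?implybT// [RHS]mulrC -/b.
  by rewrite /B /ext_form big_distrr; apply: eq_bigr => f _; rewrite /= mulrA.
- move=> f g fG gG fg cfg; rewrite lE /B /ext_form.
  rewrite (bigD1 f)//= [X in _ < X](bigD1 f)//=; apply: ltr_leD; last first.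
    by apply: ler_sum => h /andP[hG _]; exact: lB.
  rewrite -wp ltr_pM2r//; apply: gt0_ltr_powR; rewrite ?nnegrE ?invr_gt0// ?ltW//.
  rewrite /W (bigD1 f) ?fG ?eqxx//= ltrDl (bigD1 g)/=; last first.
    by rewrite gG cfg eqxx eq_sym.
  by rewrite ltr_pwDl// sumr_ge0// => h _; exact: ltW.
Qed.

(** With distinct labels, [y] is a q-unit vector indexed by edges. Hoelder with exponents q and q/p
    removes it, and x^(q/p) is a p-unit vector to test on [G]. *)
Lemma extension_le_lower (e : {set G}) : e \in edges G ->
  {in edges G &, injective c} ->
  spectral_radius q (extension c) <=
    split_const r q * (spectral_radius p G / r%:R) `^ (p / q).
Proof.
move=> eG cinj.
have [x [y [xpos y0 _ [x1 y1 le]]]] := extension_attained c r_gt0 Gni rq eG.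
have x0 v : 0 <= x v by exact: ltW.
apply: (le_trans le); rewrite ler_pM2l ?split_const_gt0//.
pose z v := x v `^ (q / p).
have z0 v : 0 <= z v by exact: powR_ge0.
have z1 : \sum_v z v `^ p = 1.
  by rewrite -x1; apply: eq_bigr => v _; rewrite -powRrM divfK ?gt_eqF.
have conj : q^-1 + (q / p)^-1 = 1.
  by rewrite invf_div -[X in X + _]mul1r -mulrDl addrC divff ?gt_eqF.
have y1' : \sum_(f in edges G) y (c f) `^ q = 1 by rewrite -y1 big_imset.
rewrite -(invf_div q p).
apply: (le_trans (holder_unit_sum q0 _ conj _ _ y1')) => //.
- by rewrite divr_gt0.
- by move=> f; exact: prodr_ge0.
apply: ge0_ler_powR; rewrite ?nnegrE.
- by rewrite invr_ge0 divr_ge0 ?ltW.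
- by apply: sumr_ge0 => *; exact: powR_ge0.
- by rewrite divr_ge0 ?ltW// (spectral_radius_gt0 p0 r_gt0 eG).
have -> : \sum_(f in edges G) (\prod_(v in f) x v) `^ (q / p) =
    \sum_(f in edges G) \prod_(v in f) z v.
  by apply: eq_bigr => f _; rewrite powR_prod.
rewrite sum_edges ler_pM2r ?invr_gt0//.
by have := hpoly_le_spectral_radius p0 r_gt0 z0; rewrite z1 powR1 expr1n mulr1.
Qed.

End Bounds.

(** * The edgeless case and the assembly of the theorem *)

Lemma spectral_radius_edgeless (R : realType) k (p : R) (G : uhypergraph k) :
  edges G = finset.set0 -> spectral_radius p G = 0.
Proof.
move=> G0; have P0 (x : G -> R) : hpoly x = 0 by rewrite /hpoly G0 big_set0 mulr0.
rewrite /spectral_radius; set A := [set x | pnorm p x = 1]%classic.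
have [->|/set0P[x Ax]] := eqVneq A set0%classic; first by rewrite image_set0 sup0.
rewrite (_ : image _ _ = [set 0]%classic) ?sup1//.
by apply/seteqP; split=> [_ [y _ <-]|_ ->]; [exact: P0|exists x].
Qed.

Unset Implicit Arguments.
Set Strict Implicit.

Theorem theorem3p13 (R : realType) (r : nat) (p : R)
    (G : uhypergraph r) (H : uhypergraph r.+1)
    (r_gt0 : (0 < r)%N) (Gni : no_isolated G) (GH : is_extension G H)
    (rp : r%:R < p) :
  let lower := (((r%:R + 1) / r%:R) `^ (p - r%:R)
                 * spectral_radius p G `^ p) `^ (1 / (p + 1)) in
  let upper := ((r%:R + 1) `^ (p - r%:R) / r%:R `^ (p + 1 - r%:R))
                 `^ (1 / (p + 1)) * spectral_radius (p + 1) G in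
  [/\ lower <= spectral_radius (p + 1) H,
      spectral_radius (p + 1) H <= upper,
      lower = spectral_radius (p + 1) H <-> hiso H (ext_distinct G)
    & spectral_radius (p + 1) H = upper <-> hiso H (ext_join_K1 G)].
Proof.
move=> lower upper; case: GH => C [c Hc].
rewrite (hiso_spectral_radius (p + 1) Hc).
(* Without edges both bounds and the radius are 0, and any two labellings agree vacuously, so both
   equalities and both isomorphisms hold. *)
have [E0|[e eG]] := set_0Vmem (edges G).
  have lam0 : spectral_radius (p + 1) (extension c) = 0.
    by apply: spectral_radius_edgeless; rewrite /= E0 imset0.
  have lower0 : lower = 0.
    rewrite /lower spectral_radius_edgeless// [0 `^ p]powR0 ?mulr0.
      by rewrite powR0// div1r invr_eq0 gt_eqF// addr_gt0// (le_lt_trans _ rp).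
    by rewrite gt_eqF// (le_lt_trans _ rp).
  have upper0 : upper = 0 by rewrite /upper spectral_radius_edgeless// mulr0.
  rewrite lam0 lower0 upper0; split=> //; split=> // _;
    apply: hiso_trans Hc _; apply: hiso_extension => f g;
    by rewrite E0 inE.
have lowerE : lower = split_const r (p + 1) *
    (spectral_radius p G / r%:R) `^ (p / (p + 1)).
  rewrite /lower (split_const_lower r_gt0 rp)// ltW//.
  by rewrite (spectral_radius_gt0 _ r_gt0 eG)// (le_lt_trans _ rp).
have upperE : upper = split_const r (p + 1) * (spectral_radius (p + 1) G / r%:R).
  by rewrite /upper (split_const_upper r_gt0 rp) mulrAC mulrA.
have [B [lB Ble Blt]] := lower_le_extension c r_gt0 Gni rp eG.
have p0 : 0 < p by exact: le_lt_trans rp.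
have lp0 : 0 <= spectral_radius p G / r%:R.
  by rewrite divr_ge0// ltW// (spectral_radius_gt0 p0 r_gt0 eG).
have pq0 : 0 < p / (p + 1) by rewrite divr_gt0// addr_gt0.
have uB : lower <= spectral_radius (p + 1) (extension c).
  rewrite lowerE; apply: le_trans Ble; rewrite ler_pM2l ?split_const_gt0//.
  by apply: ge0_ler_powR; rewrite ?nnegrE ?(ltW pq0)// (le_trans lp0).
split=> //.
- by rewrite upperE (extension_le_upper c r_gt0 Gni rp eG).
- split=> [lE|HG].
    apply: (hiso_trans Hc); apply: hiso_extension => f g fG gG.
    apply/eqP/eqP => [cfg|->//]; apply/eqP; apply: contraT => fg.
    (* Two distinct edges sharing a label would make the left inequality strict. *)
    have lt := Blt f g fG gG fg cfg.
    have : lower < spectral_radius (p + 1) (extension c).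
      rewrite lowerE; apply: lt_le_trans Ble; rewrite ltr_pM2l ?split_const_gt0//.
      by apply: gt0_ltr_powR; rewrite ?nnegrE// (le_trans lp0).
    by rewrite lE ltxx.
  (* The missing inequality is proved for the model extension, whose labelling is injective, and
     transported by isomorphism invariance. *)
  apply/eqP; rewrite eq_le uB/= lowerE.
  rewrite -(hiso_spectral_radius (p + 1) Hc) (hiso_spectral_radius (p + 1) HG).
  apply: (extension_le_lower r_gt0 Gni rp eG).
  exact: in2W.
- split=> [lE|HG].
    apply: (hiso_trans Hc); apply: hiso_extension => f g fG gG.
    rewrite eqxx; apply: contraT => fg.
    by have := extension_lt_upper r_gt0 Gni rp fG gG fg; rewrite lE upperE ltxx.
  apply/eqP; rewrite eq_le {1}upperE (extension_le_upper c r_gt0 Gni rp eG)/=.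
  rewrite -(hiso_spectral_radius (p + 1) Hc) (hiso_spectral_radius (p + 1) HG).
  rewrite upperE.
  exact: (upper_le_extension r_gt0 rp eG).
Qed.
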